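(* Let $c\in\big(0,\tfrac{\pi}{\sqrt{2}}\big)$ and, for $n\ge 3$, put \[ L_n=c\sqrt{\frac{n}{\log n}},\qquad z_n=-\frac{e^{L_n}}{1+e^{L_n}}. \] Then \[ \lim_{n\to\infty}\left(\frac{(1+z)P_n(z)\big((\ell(z))^2+\pi^2\big)^{(n+1)/2}}{n!}-J_n(z)\right)=0 \] uniformly for $z\in[z_n,-1-z_n]$; that is, the supremum over $z\in[z_n,-1-z_n]$ of the absolute value of the expression in parentheses tends to $0$ as $n\to\infty$.
   Context: The Geometric polynomials $(P_n(z))_{n\ge0}$ are defined by the exponential generating function \[ \frac{1}{1-z(e^t-1)}=\sum_{n=0}^\infty P_n(z)\frac{t^n}{n!}. \] For $z\in(-1,0)$ put $\ell(z)=\log\left|\frac{1+z}{z}\right|$ and \[ J_n(z)=\frac{(\ell(z)+\pi i)^{n+1}+(\ell(z)-\pi i)^{n+1}}{\big((\ell(z))^2+\pi^2\big)^{(n+1)/2}}. \] *)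

(* Defs.v *)
(* Library world: Stdlib reals and Coquelicot. *)
From Stdlib Require Import Reals Factorial.
From Coquelicot Require Import Coquelicot.
Open Scope R_scope.

(* The generating function identity, for every real z and all t in a
   neighbourhood of 0 (depending on z).  Equality of the power series near 0
   fixes each coefficient P n z / n!, hence determines P. *)
Definition geometric_polynomials (P : nat -> R -> R) : Prop :=
  forall z : R,
    locally 0 (fun t : R =>
      is_series (fun n : nat => P n z * (t ^ n / INR (fact n)))
                (1 / (1 - z * (exp t - 1)))).

Definition ell (z : R) : R := ln (Rabs ((1 + z) / z)).

(* Real powers x^{(n+1)/2}, x > 0, are written with [Rpower]. *)
Definition ell_pow (n : nat) (z : R) : R :=
  Rpower ((ell z) ^ 2 + PI ^ 2) ((INR n + 1) / 2).

Definition J (n : nat) (z : R) : C :=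
  (((RtoC (ell z) + RtoC PI * Ci) ^ (n + 1)
    + (RtoC (ell z) - RtoC PI * Ci) ^ (n + 1)) / RtoC (ell_pow n z))%C.

Definition Lseq (c : R) (n : nat) : R := c * sqrt (INR n / ln (INR n)).

Definition zseq (c : R) (n : nat) : R :=
  - (exp (Lseq c n) / (1 + exp (Lseq c n))).

(* [J n z] is complex by its formula, so the difference is taken in C. *)
Definition deviation (P : nat -> R -> R) (n : nat) (z : R) : C :=
  (RtoC ((1 + z) * P n z * ell_pow n z / INR (fact n)) - J n z)%C.

(* Main.v *)
Require Import Defs.
From Stdlib Require Import Reals Factorial Lra Lia.
From Coquelicot Require Import Coquelicot.
Open Scope R_scope.

(** Multiplied by [1 + z], the generating function becomes [1 / (1 + exp (t - l))]
    with [l = ell z], whose poles are [l + (2k+1) pi i], all simple with residue -1;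
    hence, for [n >= 1], [(1 + z) P_n(z) / n!] is the sum of [(l + (2k+1) pi i)^-(n+1)]
    over all integers [k].  After multiplication by [|l + pi i|^(n+1)] the two poles
    nearest to 0 give [J_n(z)], and the other ones contribute [O(1/n)] because
    [l^2 <= c^2 n / log n].

    The partial fraction expansion
    [tanh (s/2) = sum_k 4s / (s^2 + ((2k+1) pi)^2)] is obtained on the real line by
    iterating the duplication formula of [sinh a / (cosh a - cos b)] and letting the
    number of iterations tend to infinity under dominated convergence.  The Taylor
    coefficients are then read off without complex analysis: the sums
    [h_n(t) = sum_k 2 Re (1 / (tau_k^n (tau_k - t)))] satisfy
    [h_n(t) - h_n(0) = t h_(n+1)(t)], so [h_n(0)] is the [n]-th coefficient. *)

(** * Dominated convergence for series *)

(** The partial sums telescope against [1/((x+1)(x+2))]. This series dominates every sum over poles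
    below. *)
Lemma ex_series_inv_odd_sqr : ex_series (fun k => / (2 * INR k + 1) ^ 2).
Proof.
assert (H : forall n, sum_f_R0 (fun k => / (2 * INR k + 1) ^ 2) n <= 2 - / (INR n + 1)).
{ induction n as [|n IH].
  - simpl. lra.
  - rewrite tech5, S_INR.
    apply Rle_trans with (1 := Rplus_le_compat_r _ _ _ IH).
    pose proof (pos_INR n) as Hn. set (x := INR n) in *.
    assert (/ (2 * (x + 1) + 1) ^ 2 <= / ((x + 1) * (x + 1 + 1))).
    { apply Rinv_le_contravar; nra. }
    assert (/ ((x + 1) * (x + 1 + 1)) = / (x + 1) - / (x + 1 + 1)) by (field; lra).
    lra. }
destruct (ex_finite_lim_seq_incr (sum_f_R0 (fun k => / (2 * INR k + 1) ^ 2)) 2) as [l Hl].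
- intros n. rewrite tech5.
  pose proof (pos_INR (S n)).
  assert (0 < / (2 * INR (S n) + 1) ^ 2) by (apply Rinv_0_lt_compat; nra). lra.
- intros n. apply Rle_trans with (1 := H n).
  pose proof (pos_INR n).
  assert (0 < / (INR n + 1)) by (apply Rinv_0_lt_compat; lra). lra.
- exists l. apply is_series_Reals. apply is_lim_seq_Reals in Hl. exact Hl.
Qed.

Lemma ex_series_dominated (a M : nat -> R) :
  (forall k, Rabs (a k) <= M k) -> ex_series M -> ex_series a.
Proof. intros H. exact (ex_series_le (V := R_CompleteNormedModule) a M H). Qed.

Lemma Series_dominated (a M : nat -> R) :
  (forall k, Rabs (a k) <= M k) -> ex_series M -> Rabs (Series a) <= Series M.
Proof.
intros H HM.
apply Rle_trans with (Series (fun k => Rabs (a k))).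
- apply Series_Rabs. apply ex_series_dominated with M; auto.
  intros k; rewrite Rabs_Rabsolu; auto.
- apply Series_le; auto. intros k; split; auto using Rabs_pos.
Qed.

(** Cut at an index [m] beyond which the tail of [M] is below [eps / 2]: the finite head tends to 0,
    and the tail is dominated uniformly in [j]. *)
Lemma tannery_zero (h : nat -> nat -> R) (M : nat -> R) :
  ex_series M -> (forall j k, Rabs (h j k) <= M k) ->
  (forall k, is_lim_seq (fun j => h j k) 0) ->
  is_lim_seq (fun j => Series (h j)) 0.
Proof.
intros HM Hb Hl.
assert (Hs : forall m, is_lim_seq (fun j => sum_f_R0 (h j) m) 0).
{ induction m as [|m IH].
  - apply Hl.
  - simpl. replace 0 with (0 + 0) by ring. apply is_lim_seq_plus'; auto. }
apply is_lim_seq_spec. intros eps.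
assert (He : 0 < eps / 2) by (destruct eps; simpl; lra).
assert (Hm : exists m, Rabs (sum_f_R0 M m - Series M) < eps / 2).
{ pose proof (Series_correct M HM) as HS. apply is_series_Reals in HS.
  destruct (HS _ He) as [m Hm]. exists m. apply Hm; auto. }
destruct Hm as [m Hm].
specialize (Hs m). apply is_lim_seq_spec in Hs.
destruct (Hs (mkposreal _ He)) as [N HN]. simpl in HN.
exists N. intros j Hj. specialize (HN j Hj).
rewrite Rminus_0_r in HN |- *.
rewrite (Series_incr_n (h j) (S m)); [simpl pred | lia | apply ex_series_dominated with M; auto].
rewrite (Series_incr_n M (S m)) in Hm; [simpl pred in Hm | lia | auto].
assert (Rabs (Series (fun k => h j (S m + k)%nat)) <= Series (fun k => M (S m + k)%nat)).
{ apply Series_dominated; auto. apply ex_series_incr_n; auto. }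
pose proof (Rabs_triang (sum_f_R0 (h j) m) (Series (fun k => h j (S m + k)%nat))).
assert (Rabs (Series (fun k : nat => M (S m + k)%nat)) < eps / 2).
{ rewrite <- Rabs_Ropp. eapply Rle_lt_trans; [|exact Hm]. right; f_equal; ring. }
pose proof (Rle_abs (Series (fun k : nat => M (S m + k)%nat))). lra.
Qed.

(** Tannery's theorem. The bound [M] passes to the limit [g], so [f j k - g k] is dominated by [2 M]
    and the case of limit zero applies. *)
Lemma tannery (f : nat -> nat -> R) (g M : nat -> R) :
  ex_series M -> (forall j k, Rabs (f j k) <= M k) ->
  (forall k, is_lim_seq (fun j => f j k) (g k)) ->
  is_lim_seq (fun j => Series (f j)) (Series g).
Proof.
intros HM Hb Hl.
assert (Hg : forall k, Rabs (g k) <= M k).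
{ intros k. apply (is_lim_seq_le (fun j => Rabs (f j k)) (fun _ => M k) (Rabs (g k)) (M k)).
  - auto.
  - apply (is_lim_seq_abs _ (g k)). auto.
  - apply is_lim_seq_const. }
apply is_lim_seq_ext with (fun j => Series (fun k => f j k - g k) + Series g).
- intros j. rewrite Series_minus.
  + ring.
  + apply ex_series_dominated with M; auto.
  + apply ex_series_dominated with M; auto.
- replace (Finite (Series g)) with (Finite (0 + Series g)) by (f_equal; ring).
  apply is_lim_seq_plus'; [|apply is_lim_seq_const].
  apply tannery_zero with (fun k => M k + M k).
  + apply (ex_series_plus (V := R_NormedModule)); auto.
  + intros j k. unfold Rminus. eapply Rle_trans; [apply Rabs_triang|].
    rewrite Rabs_Ropp. specialize (Hb j k). specialize (Hg k). lra.
  + intros k. replace 0 with (g k - g k) by ring.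
    apply is_lim_seq_minus'; [auto | apply is_lim_seq_const].
Qed.

(** The strict upper bound lets a sum of [2 ^ j] terms be written without a predecessor. *)
Fixpoint sum_lt (f : nat -> R) (n : nat) : R :=
  match n with O => 0 | S n => sum_lt f n + f n end.

Lemma sum_lt_ext (f g : nat -> R) n :
  (forall k, (k < n)%nat -> f k = g k) -> sum_lt f n = sum_lt g n.
Proof.
induction n as [|n IH]; simpl; intros H; auto.
rewrite IH, H; auto.
Qed.

Lemma sum_lt_scal c f n : sum_lt (fun k => c * f k) n = c * sum_lt f n.
Proof. induction n as [|n IH]; simpl; [ring | rewrite IH; ring]. Qed.

Lemma sum_lt_Sl f n : sum_lt f (S n) = f O + sum_lt (fun k => f (S k)) n.
Proof.
induction n as [|n IH]; [simpl; ring|].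
change (sum_lt f (S (S n))) with (sum_lt f (S n) + f (S n)). rewrite IH. simpl. ring.
Qed.

(** Each index is paired with its mirror image; in [kernel_sum] mirrored indices carry supplementary
    angles [b] and [PI - b]. *)
Lemma sum_lt_pair f n :
  sum_lt f (2 * n) = sum_lt (fun k => f k + f (2 * n - 1 - k)%nat) n.
Proof.
revert f; induction n as [|n IH]; intros f; [reflexivity|].
replace (2 * S n)%nat with (S (S (2 * n))) by lia.
rewrite (sum_lt_Sl _ n), (sum_lt_Sl _ (S (2 * n))).
change (sum_lt (fun k => f (S k)) (S (2 * n)))
  with (sum_lt (fun k => f (S k)) (2 * n) + f (S (2 * n))).
rewrite IH.
replace (S (S (2 * n)) - 1 - 0)%nat with (S (2 * n)) by lia.
rewrite (sum_lt_ext (fun k => f (S k) + f (S (2 * n - 1 - k)))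
   (fun k => f (S k) + f (S (S (2 * n)) - 1 - S k)%nat)); [ring|].
intros k Hk. do 2 f_equal. lia.
Qed.

(** Padding with zeros turns sums of varying length into series, the form to which [tannery]
    applies. *)
Lemma Series_sum_lt f n :
  Series (fun k => if (k <? n)%nat then f k else 0) = sum_lt f n.
Proof.
assert (Hs : forall m, sum_n (fun k => if (k <? n)%nat then f k else 0) m
   = sum_lt f (Nat.min n (S m))).
{ induction m as [|m IH].
  - rewrite sum_O. destruct n; [reflexivity|].
    replace (Nat.min (S n) 1) with 1%nat by lia. simpl. ring.
  - rewrite sum_Sn, IH. unfold plus; simpl AbelianMonoid.plus.
    destruct (Nat.ltb_spec (S m) n).
    + replace (Nat.min n (S (S m))) with (S (S m)) by lia.
      replace (Nat.min n (S m)) with (S m) by lia. reflexivity.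
    + replace (Nat.min n (S (S m))) with n by lia.
      replace (Nat.min n (S m)) with n by lia. apply Rplus_0_r. }
apply is_series_unique.
enough (H : is_lim_seq (sum_n (fun k => if (k <? n)%nat then f k else 0)) (sum_lt f n)) by exact H.
apply is_lim_seq_ext_loc with (fun _ => sum_lt f n); [|apply is_lim_seq_const].
exists n. intros m Hm. rewrite Hs. f_equal. lia.
Qed.

(** * Partial fractions of the hyperbolic tangent *)

(** This is the real part of [coth((a + ib)/2)], a form of the Poisson kernel. *)
Definition kernel (a b : R) : R := sinh a / (cosh a - cos b).

Lemma cosh_sqr a : cosh a ^ 2 = 1 + sinh a ^ 2.
Proof.
unfold cosh, sinh. rewrite exp_Ropp. pose proof (exp_pos a). field. lra.
Qed.

Lemma sinh_double a : sinh (2 * a) = 2 * sinh a * cosh a.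
Proof.
unfold cosh, sinh. replace (- (2 * a)) with (- a + - a) by ring.
replace (2 * a) with (a + a) by ring. rewrite !exp_plus. field.
Qed.

Lemma cosh_double a : cosh (2 * a) = 2 * cosh a ^ 2 - 1.
Proof.
unfold cosh. replace (- (2 * a)) with (- a + - a) by ring.
replace (2 * a) with (a + a) by ring. rewrite !exp_plus, exp_Ropp.
pose proof (exp_pos a). field. lra.
Qed.

Lemma cosh_ge_1 a : 1 <= cosh a.
Proof.
assert (0 < cosh a).
{ unfold cosh. pose proof (exp_pos a). pose proof (exp_pos (- a)). lra. }
pose proof (cosh_sqr a). nra.
Qed.

(** [cosh 2a - cos 2b] factors as [2 (cosh a - cos b)(cosh a + cos b)]. Since [sin b] is positive,
    [cos b] lies strictly between -1 and 1, so both factors are positive. *)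
Lemma kernel_double a b : 0 < sin b ->
  kernel (2 * a) (2 * b) = / 2 * (kernel a b + kernel a (PI - b)).
Proof.
intros Hb. unfold kernel.
rewrite sinh_double, cosh_double, cos_2a_cos, cos_minus, cos_PI, sin_PI.
pose proof (cosh_ge_1 a). pose proof (sin2_cos2 b) as H2. unfold Rsqr in H2.
assert (-1 < cos b < 1) by nra.
field. repeat split; nra.
Qed.

(** Each duplication replaces an angle by its half and the supplement of that half; together these
    are the odd multiples of [PI / 2 ^ (j+2)] below [PI]. *)
Lemma kernel_sum s j :
  kernel s PI =
  / 2 ^ j * sum_lt (fun k => kernel (s / 2 ^ S j) ((2 * INR k + 1) * PI / 2 ^ S j)) (2 ^ j).
Proof.
induction j as [|j IH].
- simpl. rewrite Rmult_1_r, Rmult_0_r, !Rplus_0_l, Rmult_1_l, Rinv_1, Rmult_1_l.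
  replace (kernel s PI) with (kernel (2 * (s / 2)) (2 * (PI / 2))) by (f_equal; field).
  rewrite kernel_double by (rewrite sin_PI2; lra).
  replace (PI - PI / 2) with (PI / 2) by field. field.
- rewrite IH.
  replace (2 ^ S j)%nat with (2 * 2 ^ j)%nat by reflexivity.
  rewrite sum_lt_pair.
  rewrite (sum_lt_ext _ (fun k => / 2 * (kernel (s / 2 ^ S (S j)) ((2 * INR k + 1) * PI / 2 ^ S (S j))
    + kernel (s / 2 ^ S (S j)) ((2 * INR (2 * 2 ^ j - 1 - k) + 1) * PI / 2 ^ S (S j))))).
  + rewrite sum_lt_scal. simpl pow. field. apply pow_nonzero; lra.
  + intros k Hk.
    assert (Hp : 0 < 2 ^ j) by (apply pow_lt; lra).
    assert (HK : INR k + 1 <= 2 ^ j).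
    { change 2 with (INR 2). rewrite <- pow_INR, <- S_INR. apply le_INR. lia. }
    pose proof (pos_INR k). pose proof PI_RGT_0.
    replace (s / 2 ^ S j) with (2 * (s / 2 ^ S (S j))) by (simpl; field; lra).
    replace ((2 * INR k + 1) * PI / 2 ^ S j) with (2 * ((2 * INR k + 1) * PI / 2 ^ S (S j)))
      by (simpl; field; lra).
    rewrite kernel_double.
    * do 3 f_equal. rewrite !minus_INR, mult_INR, pow_INR by lia.
      change (INR 2) with 2. change (INR 1) with 1. simpl pow. field. lra.
    * apply sin_gt_0.
      -- apply Rdiv_lt_0_compat; [nra | apply pow_lt; lra].
      -- apply (Rmult_lt_reg_r (2 ^ S (S j))); [apply pow_lt; lra|].
         unfold Rdiv. rewrite Rmult_assoc, Rinv_l by (apply pow_nonzero; lra).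
         simpl pow. nra.
Qed.

(** For nonzero [u] this is the difference quotient of [f] at 0 along [u / 2 ^ j]. *)
Lemma is_lim_seq_rescale (f : R -> R) (d u : R) :
  f 0 = 0 -> derivable_pt_lim f 0 d ->
  is_lim_seq (fun j => 2 ^ j * f (u / 2 ^ j)) (u * d).
Proof.
intros f0 Hf.
destruct (Req_dec u 0) as [->|Hu].
- apply is_lim_seq_ext with (fun _ => 0).
  + intros j. unfold Rdiv. rewrite Rmult_0_l, f0. ring.
  + rewrite Rmult_0_l. apply is_lim_seq_const.
- assert (H0 : is_lim_seq (fun j => u / 2 ^ j) 0).
  { apply is_lim_seq_ext with (fun j => u * (/ 2) ^ j).
    - intros j. rewrite pow_inv. reflexivity.
    - replace (Finite 0) with (Rbar_mult u 0) by (simpl; f_equal; ring).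
      apply is_lim_seq_scal_l, is_lim_seq_geom. rewrite Rabs_pos_eq; lra. }
  apply is_lim_seq_ext with (fun j => u * ((f (0 + u / 2 ^ j) - f 0) / (u / 2 ^ j))).
  + intros j. rewrite f0, Rplus_0_l. field. split; auto. apply pow_nonzero; lra.
  + apply (is_lim_seq_scal_l _ u d).
    apply is_lim_seq_spec. intros eps.
    destruct (Hf eps (cond_pos eps)) as [del Hdel].
    apply is_lim_seq_spec in H0. destruct (H0 del) as [N HN].
    exists N. intros j Hj. apply Hdel.
    * unfold Rdiv. apply Rmult_integral_contrapositive_currified; auto.
      apply Rinv_neq_0_compat, pow_nonzero; lra.
    * specialize (HN j Hj). rewrite Rminus_0_r in HN. exact HN.
Qed.

Lemma sinh_rescale u : is_lim_seq (fun j => 2 ^ j * sinh (u / 2 ^ j)) u.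
Proof.
replace (Finite u) with (Finite (u * 1)) by (f_equal; ring). rewrite <- cosh_0.
apply is_lim_seq_rescale; [apply sinh_0 | apply derivable_pt_lim_sinh].
Qed.

Lemma sin_rescale u : is_lim_seq (fun j => 2 ^ j * sin (u / 2 ^ j)) u.
Proof.
replace (Finite u) with (Finite (u * 1)) by (f_equal; ring). rewrite <- cos_0.
apply is_lim_seq_rescale; [apply sin_0 | apply derivable_pt_lim_sin].
Qed.

(** From [sin y >= y - y^3/6], where [y^2 <= 4]. *)
Lemma sin_lower y : 0 <= y <= 2 -> y / 3 <= sin y.
Proof.
intros [H0 H2].
assert (Hpi : 2 <= PI) by (pose proof PI2_1; lra).
pose proof (proj1 (sin_bound y 0 H0 ltac:(lra))) as H.
unfold sin_approx, sin_term in H. simpl in H.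
eapply Rle_trans; [|exact H].
assert (y * y <= 4) by nra. assert (y * (y * y) <= y * 4) by (apply Rmult_le_compat_l; auto).
lra.
Qed.

(** As a sum of two squares, the denominator can be bounded below by its sine part alone. *)
Lemma kernel_half a b :
  kernel a b = sinh a / (2 * (sinh (a / 2) ^ 2 + sin (b / 2) ^ 2)).
Proof.
unfold kernel. f_equal.
replace a with (2 * (a / 2)) at 1 by field.
replace b with (2 * (b / 2)) at 1 by field.
rewrite cosh_double, cos_2a_sin, cosh_sqr. ring.
Qed.

(** The powers of 2 are distributed so that every factor has the form [2 ^ m * f (u / 2 ^ m)], whose
    limit is known. *)
Lemma kernel_scaled s b j :
  / 2 ^ j * kernel (s / 2 ^ S j) (b / 2 ^ S j) =
  (2 ^ S j * sinh (s / 2 ^ S j)) /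
  (/ 4 * ((2 ^ S (S j) * sinh (s / 2 ^ S (S j))) ^ 2 + (2 ^ S (S j) * sin (b / 2 ^ S (S j))) ^ 2)).
Proof.
assert (Hp : 0 < 2 ^ j) by (apply pow_lt; lra).
rewrite kernel_half.
replace (s / 2 ^ S j / 2) with (s / 2 ^ S (S j)) by (simpl; field; lra).
replace (b / 2 ^ S j / 2) with (b / 2 ^ S (S j)) by (simpl; field; lra).
set (x := sinh (s / 2 ^ S (S j))). set (y := sin _).
simpl pow. rewrite !Rmult_1_r.
(* If the denominator vanishes, both sides are 0 by the convention [/ 0 = 0]. *)
destruct (Req_dec (x * x + y * y) 0) as [E|E].
- replace (/ 4 * (2 * (2 * 2 ^ j) * x * (2 * (2 * 2 ^ j) * x) + 2 * (2 * 2 ^ j) * y * (2 * (2 * 2 ^ j) * y)))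
    with (4 * 2 ^ j * 2 ^ j * (x * x + y * y)) by field.
  rewrite E. rewrite !Rmult_0_r. unfold Rdiv. rewrite Rinv_0. ring.
- field. repeat split; try lra.
  replace (2 * (2 * 2 ^ j) * x * (2 * (2 * 2 ^ j) * x) + 2 * (2 * 2 ^ j) * y * (2 * (2 * 2 ^ j) * y))
    with (16 * (2 ^ j * 2 ^ j) * (x * x + y * y)) by ring.
  repeat apply Rmult_integral_contrapositive_currified; lra.
Qed.

(* [kernel s PI] is [tanh (s / 2)]. *)
Lemma kernel_PI_series s :
  kernel s PI = Series (fun k => 4 * s / (s ^ 2 + ((2 * INR k + 1) * PI) ^ 2)).
Proof.
set (b := fun k => (2 * INR k + 1) * PI).
(* For every [j] the series of [f j] equals [kernel s PI]; only its termwise limit as [j] grows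
   remains to be found. *)
set (f := fun j k => if (k <? 2 ^ j)%nat
   then / 2 ^ j * kernel (s / 2 ^ S j) (b k / 2 ^ S j) else 0).
assert (Hb : forall k, 0 < b k).
{ intros k. unfold b. pose proof PI_RGT_0. pose proof (pos_INR k). nra. }
assert (Hf : forall j, Series (f j) = kernel s PI).
{ intros j. unfold f. rewrite Series_sum_lt, sum_lt_scal. symmetry. apply kernel_sum. }
assert (HN : is_lim_seq (fun j => 2 ^ S j * sinh (s / 2 ^ S j)) s).
{ apply (is_lim_seq_incr_1 (fun j => 2 ^ j * sinh (s / 2 ^ j))), sinh_rescale. }
destruct (filterlim_bounded (V := R_NormedModule) (fun j => 2 ^ S j * sinh (s / 2 ^ S j)))
  as [A HA].
{ exists s. exact HN. }
change (forall n, Rabs (2 ^ S n * sinh (s / 2 ^ S n)) <= A) in HA.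
assert (HA0 : 0 <= A) by (apply Rle_trans with (2 := HA O), Rabs_pos).
enough (Hlim : is_lim_seq (fun j => Series (f j)) (Series (fun k => 4 * s / (s ^ 2 + b k ^ 2)))).
{ apply is_lim_seq_ext with (v := fun _ => kernel s PI) in Hlim; [|exact Hf].
  apply is_lim_seq_unique in Hlim. rewrite Lim_seq_const in Hlim. injection Hlim as Hlim. exact Hlim. }
(* [A] bounds the numerators, and [sin_lower] bounds the denominators below by [(b k / 6) ^ 2];
   hence the factor 36. *)
apply tannery with (fun k => (36 * A / PI ^ 2) * / (2 * INR k + 1) ^ 2).
- apply (ex_series_scal (V := R_NormedModule)), ex_series_inv_odd_sqr.
- intros j k. unfold f. pose proof PI_RGT_0 as Hpi. pose proof (pos_INR k) as Hk.
  replace (36 * A / PI ^ 2 * / (2 * INR k + 1) ^ 2) with (A * / (b k / 6) ^ 2)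
    by (unfold b; field; lra).
  assert (Hi : 0 < / (b k / 6) ^ 2).
  { apply Rinv_0_lt_compat, pow_lt. specialize (Hb k). lra. }
  destruct (Nat.ltb_spec k (2 ^ j)) as [Hlt|Hge].
  2:{ rewrite Rabs_R0. apply Rmult_le_pos; lra. }
  rewrite kernel_scaled. unfold Rdiv at 1. rewrite Rabs_mult.
  apply Rmult_le_compat; auto using Rabs_pos.
  set (x := 2 ^ S (S j) * sinh _).
  assert (Hp : 0 < 2 ^ j) by (apply pow_lt; lra).
  assert (HK : INR k + 1 <= 2 ^ j).
  { change 2 with (INR 2). rewrite <- pow_INR, <- S_INR. apply le_INR. lia. }
  assert (Hq : 0 < 2 ^ S (S j)) by (apply pow_lt; lra).
  assert (Hy : 0 <= b k / 2 ^ S (S j) <= 2).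
  { split.
    - apply Rlt_le, Rdiv_lt_0_compat; auto.
    - apply (Rmult_le_reg_r (2 ^ S (S j))); auto.
      unfold Rdiv. rewrite Rmult_assoc, Rinv_l by lra. simpl pow.
      unfold b. pose proof PI_4. nra. }
  apply sin_lower in Hy.
  assert (Hy2 : b k / 3 <= 2 ^ S (S j) * sin (b k / 2 ^ S (S j))).
  { apply (Rmult_le_compat_l (2 ^ S (S j))) in Hy; [|lra].
    replace (b k / 3) with (2 ^ S (S j) * (b k / 2 ^ S (S j) / 3)) by (field; lra). exact Hy. }
  set (y := 2 ^ S (S j) * sin _) in *.
  specialize (Hb k).
  assert (Hd : (b k / 6) ^ 2 <= / 4 * (x ^ 2 + y ^ 2)).
  { pose proof (pow2_ge_0 x).
    assert ((b k / 3) ^ 2 <= y ^ 2) by (apply pow_incr; lra). lra. }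
  assert (0 < (b k / 6) ^ 2) by (apply pow_lt; lra).
  rewrite Rabs_pos_eq.
  + apply Rinv_le_contravar; auto.
  + apply Rlt_le, Rinv_0_lt_compat. lra.
- intros k. specialize (Hb k).
  apply is_lim_seq_ext_loc with (fun j => (2 ^ S j * sinh (s / 2 ^ S j)) /
  (/ 4 * ((2 ^ S (S j) * sinh (s / 2 ^ S (S j))) ^ 2 + (2 ^ S (S j) * sin (b k / 2 ^ S (S j))) ^ 2))).
  { exists k. intros j Hj. unfold f. rewrite kernel_scaled.
    destruct (Nat.ltb_spec k (2 ^ j)); auto.
    assert (j < 2 ^ j)%nat by (apply Nat.pow_gt_lin_r; lia). lia. }
  replace (4 * s / (s ^ 2 + b k ^ 2)) with (s / (/ 4 * (s * s + b k * b k))).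
  2:{ field. nra. }
  apply is_lim_seq_div'; auto.
  2:{ apply Rmult_integral_contrapositive_currified; nra. }
  apply (is_lim_seq_scal_l _ (/ 4) (s * s + b k * b k)).
  assert (HS : forall g, forall l : R, is_lim_seq (fun j => 2 ^ j * g (l / 2 ^ j)) l ->
    is_lim_seq (fun j => (2 ^ S (S j) * g (l / 2 ^ S (S j))) ^ 2) (l * l)).
  { intros g l H.
    apply is_lim_seq_ext with (fun j => (2 ^ S (S j) * g (l / 2 ^ S (S j))) * (2 ^ S (S j) * g (l / 2 ^ S (S j)))).
    - intros j. ring.
    - apply is_lim_seq_incr_1 in H. apply (is_lim_seq_incr_1 (fun j => 2 ^ S j * g (l / 2 ^ S j))) in H.
      apply is_lim_seq_mult'; exact H. }
  apply is_lim_seq_plus'; apply HS; [apply sinh_rescale | apply sin_rescale].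
Qed.

(** * Taylor coefficients *)

Lemma CV_radius_ge (a : nat -> R) (x : R) :
  ex_pseries a x -> Rbar_le (Rabs x) (CV_radius a).
Proof.
intros H. apply Rbar_not_lt_le. intros Hlt.
apply (CV_disk_outside a x Hlt). apply ex_series_lim_0.
destruct H as [l Hl]. exists l. apply is_pseries_R. exact Hl.
Qed.

(** Subtracting the constant term and dividing by [t] shifts the power series and turns [h m] into
    [h (S m)]. After [n] shifts the wanted coefficient is the constant term. *)
Lemma pseries_coeff (n : nat) (a : nat -> R) (h : nat -> R -> R) :
  (forall m, continuity_pt (h m) 0) ->
  (forall m t, h m t - h m 0 = t * h (S m) t) ->
  locally 0 (fun t => is_pseries a t (h O t)) ->
  a n = h n 0.
Proof.
revert a h; induction n as [|n IH]; intros a h Hc Hr Ha.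
- apply locally_singleton in Ha. apply is_pseries_unique in Ha.
  rewrite <- Ha. symmetry. apply PSeries_0.
- change (PS_decr_1 a n = h (S n) 0).
  apply (IH (PS_decr_1 a) (fun m => h (S m))); auto.
  assert (Ha0 : a O = h O 0).
  { apply locally_singleton in Ha. apply is_pseries_unique in Ha.
    rewrite <- Ha. symmetry. apply PSeries_0. }
  destruct Ha as [r Hr0].
  assert (Hd : forall t, Rabs t < r -> t <> 0 -> is_pseries (PS_decr_1 a) t (h 1%nat t)).
  { intros t Ht Hnz.
    assert (Hb : ball 0 r t).
    { change (Rabs (t - 0) < r). rewrite Rminus_0_r. exact Ht. }
    specialize (Hr0 t Hb).
    apply (is_pseries_decr_1 a t (/ t)) in Hr0; [|apply Rinv_l; exact Hnz].
    replace (h 1%nat t) with (scal (/ t) (plus (h O t) (opp (a O)))); [exact Hr0|].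
    rewrite Ha0. change (/ t * (h O t - h O 0) = h 1%nat t).
    rewrite Hr. field. exact Hnz. }
  assert (Hcont : continuity_pt (PSeries (PS_decr_1 a)) 0).
  { apply PSeries_continuity. rewrite Rabs_R0.
    assert (Hr2 : 0 < r / 2) by (destruct r; simpl; lra).
    apply Rbar_lt_le_trans with (Finite (Rabs (r / 2))).
    - simpl. rewrite Rabs_pos_eq; lra.
    - apply CV_radius_ge. exists (h 1%nat (r / 2)). apply Hd; [rewrite Rabs_pos_eq|]; lra. }
  (* The division by [t] says nothing at [t = 0]; there both sides are continuous and agree on a
     punctured neighbourhood. *)
  assert (Heq : PSeries (PS_decr_1 a) 0 = h 1%nat 0).
  { apply is_lim_continuity in Hcont.
    specialize (Hc 1%nat). apply is_lim_continuity in Hc.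
    apply (is_lim_ext_loc _ (h 1%nat)) in Hcont.
    - apply is_lim_unique in Hcont. apply is_lim_unique in Hc.
      rewrite Hc in Hcont. injection Hcont as Hcont. symmetry. exact Hcont.
    - exists r. intros t Hb Hnz. apply is_pseries_unique, Hd; auto.
      change (Rabs (t - 0) < r) in Hb. rewrite Rminus_0_r in Hb. exact Hb. }
  exists r. intros t Hb. change (Rabs (t - 0) < r) in Hb. rewrite Rminus_0_r in Hb.
  destruct (Req_dec t 0) as [->|Hnz]; auto.
  rewrite <- Heq, PSeries_0. exact (is_pseries_0 (PS_decr_1 a)).
Qed.

(** * Sums over the poles *)

Definition pole (l : R) (k : nat) : C := (l, (2 * INR k + 1) * PI).

Lemma pole_Im_ge (k : nat) : 1 <= 2 * INR k + 1 <= (2 * INR k + 1) * PI.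
Proof. pose proof (pos_INR k). pose proof PI2_1. nra. Qed.

Lemma Cmod_pole_ge l k : (2 * INR k + 1) * PI <= Cmod (pole l k).
Proof.
pose proof (pole_Im_ge k). unfold Cmod, pole. simpl fst; simpl snd.
apply Rle_trans with (sqrt (((2 * INR k + 1) * PI) ^ 2)).
- rewrite sqrt_pow2; lra.
- apply sqrt_le_1_alt. pose proof (pow2_ge_0 l). lra.
Qed.

Lemma Cmod_pole_gt_0 l k : 0 < Cmod (pole l k).
Proof. pose proof (pole_Im_ge k). pose proof (Cmod_pole_ge l k). lra. Qed.

Lemma pole_neq_0 l k : pole l k <> 0.
Proof. apply Cmod_gt_0, Cmod_pole_gt_0. Qed.

Lemma pole_minus l k (t : R) : (pole l k - t)%C = pole (l - t) k.
Proof. apply injective_projections; simpl; ring. Qed.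

(* Twice the real part accounts for the conjugate pair of poles. *)
Definition pole_term (n : nat) (l t : R) (k : nat) : R :=
  2 * Re (/ (pole l k ^ n * pole (l - t) k)).

(** Up to the factor [- / 2], these are the terms of [kernel_PI_series] at [s = t - l]. *)
Lemma pole_term_0 l t k :
  pole_term 0 l t k = - / 2 * (4 * (t - l) / ((t - l) ^ 2 + ((2 * INR k + 1) * PI) ^ 2)).
Proof.
unfold pole_term. simpl Cpow. rewrite Cmult_1_l.
pose proof (pole_Im_ge k). unfold Re, Cinv, pole. simpl fst; simpl snd.
set (b := (2 * INR k + 1) * PI) in *. field.
pose proof (pow2_ge_0 (t - l)). nra.
Qed.

(** From [1/(tau - t) - 1/tau = t/(tau (tau - t))], the real factor [t] coming out of the real
    part. *)
Lemma pole_term_rec n l t k :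
  pole_term n l t k - pole_term n l 0 k = t * pole_term (S n) l t k.
Proof.
unfold pole_term.
replace (2 * Re (/ (pole l k ^ n * pole (l - t) k)) - 2 * Re (/ (pole l k ^ n * pole (l - 0) k)))
  with (2 * Re (/ (pole l k ^ n * pole (l - t) k) - / (pole l k ^ n * pole (l - 0) k)))
  by (simpl; ring).
replace (t * (2 * Re (/ (pole l k ^ S n * pole (l - t) k))))
  with (2 * (t * Re (/ (pole l k ^ S n * pole (l - t) k)))) by ring.
rewrite <- (re_scal_l t). do 2 f_equal.
rewrite Rminus_0_r, Cpow_S.
assert (Ht : RtoC t = (pole l k - pole (l - t) k)%C).
{ rewrite <- pole_minus. ring. }
rewrite Ht. field. repeat split; try apply pole_neq_0. apply Cpow_nz, pole_neq_0.
Qed.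

Lemma Rabs_Re_inv_le w m : 0 < m -> m <= Cmod w -> Rabs (2 * Re (/ w)) <= 2 * / m.
Proof.
intros Hm Hw.
rewrite Rabs_mult, (Rabs_pos_eq 2) by lra.
apply Rmult_le_compat_l; [lra|].
eapply Rle_trans; [apply re_le_Cmod|].
rewrite Cmod_inv by (apply Cmod_gt_0; lra).
apply Rinv_le_contravar; auto.
Qed.

(** Two factors of modulus at least [2k+1], one from each kind of pole, give the decay; the others
    have modulus at least 1. The bound is uniform in [n], [l] and [t]. *)
Lemma pole_term_S_bound n l t k :
  Rabs (pole_term (S n) l t k) <= 2 * / (2 * INR k + 1) ^ 2.
Proof.
pose proof (pole_Im_ge k) as Hk.
apply Rabs_Re_inv_le; [apply pow_lt; lra|].
rewrite Cmod_mult, Cmod_pow.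
pose proof (Cmod_pole_ge l k). pose proof (Cmod_pole_ge (l - t) k).
assert (1 <= Cmod (pole l k) ^ n) by (apply pow_R1_Rle; lra).
simpl pow. rewrite Rmult_1_r.
apply Rmult_le_compat; try lra.
apply Rle_trans with (Cmod (pole l k) * 1); [lra|].
apply Rmult_le_compat_l; lra.
Qed.

(** At order 0 the modulus decays only like [1/k]; the real part restores the decay [1/k^2]. *)
Lemma ex_series_pole_term n l t : ex_series (pole_term n l t).
Proof.
destruct n as [|n].
- apply ex_series_dominated with (fun k => (2 * Rabs (t - l)) * / (2 * INR k + 1) ^ 2).
  + intros k. rewrite pole_term_0. pose proof (pole_Im_ge k) as Hk.
    replace (- / 2 * (4 * (t - l) / ((t - l) ^ 2 + ((2 * INR k + 1) * PI) ^ 2)))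
      with (- (2 * (t - l)) * / ((t - l) ^ 2 + ((2 * INR k + 1) * PI) ^ 2))
      by (field; pose proof (pow2_ge_0 (t - l)); nra).
    rewrite Rabs_mult, Rabs_Ropp, Rabs_mult, (Rabs_pos_eq 2) by lra.
    apply Rmult_le_compat_l; [pose proof (Rabs_pos (t - l)); lra|].
    assert ((2 * INR k + 1) ^ 2 <= ((2 * INR k + 1) * PI) ^ 2) by (apply pow_incr; lra).
    assert (0 < (2 * INR k + 1) ^ 2) by (apply pow_lt; lra).
    pose proof (pow2_ge_0 (t - l)).
    rewrite Rabs_pos_eq.
    * apply Rinv_le_contravar; lra.
    * apply Rlt_le, Rinv_0_lt_compat. lra.
  + apply (ex_series_scal (V := R_NormedModule)), ex_series_inv_odd_sqr.
- apply ex_series_dominated with (fun k => 2 * / (2 * INR k + 1) ^ 2).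
  + intros k. apply pole_term_S_bound.
  + apply (ex_series_scal (V := R_NormedModule)), ex_series_inv_odd_sqr.
Qed.

(* The constant [1/2] of the expansion only affects the coefficient of order 0. *)
Definition pole_sum (l : R) (n : nat) (t : R) : R :=
  match n with O => / 2 | S _ => 0 end + Series (pole_term n l t).

Lemma pole_sum_rec l n t :
  pole_sum l n t - pole_sum l n 0 = t * pole_sum l (S n) t.
Proof.
unfold pole_sum.
replace (t * (0 + Series (pole_term (S n) l t))) with (t * Series (pole_term (S n) l t)) by ring.
rewrite <- Series_scal_l.
rewrite (Series_ext (fun k => t * pole_term (S n) l t k) (fun k => pole_term n l t k - pole_term n l 0 k)).
- rewrite Series_minus by apply ex_series_pole_term. ring.
- intros k. symmetry. apply pole_term_rec.
Qed.

(** By [pole_sum_rec] the increment from 0 is [t] times the next sum, which is bounded uniformly in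
    [t]. *)
Lemma pole_sum_continuity l n : continuity_pt (pole_sum l n) 0.
Proof.
set (B := Series (fun k => 2 * / (2 * INR k + 1) ^ 2)).
assert (HB : forall t, Rabs (pole_sum l (S n) t) <= B).
{ intros t. unfold pole_sum. rewrite Rplus_0_l. apply Series_dominated.
  - intros k. apply pole_term_S_bound.
  - apply (ex_series_scal (V := R_NormedModule)), ex_series_inv_odd_sqr. }
assert (HB0 : 0 <= B) by (apply Rle_trans with (2 := HB 0), Rabs_pos).
intros eps Heps. exists (eps / (B + 1)). split; [apply Rdiv_lt_0_compat; lra|].
intros t [_ Ht]. simpl in Ht |- *. unfold Rdist in *. rewrite Rminus_0_r in Ht.
rewrite pole_sum_rec, Rabs_mult.
apply Rle_lt_trans with (Rabs t * (B + 1)).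
- apply Rmult_le_compat_l; [apply Rabs_pos|]. specialize (HB t). lra.
- apply (Rmult_lt_compat_r (B + 1)) in Ht; [|lra].
  unfold Rdiv in Ht. rewrite Rmult_assoc, Rinv_l in Ht; lra.
Qed.

(** This is [1/2 - tanh((t - l)/2)/2] in closed form. *)
Lemma pole_sum_0 l t : pole_sum l 0 t = / (1 + exp (t - l)).
Proof.
unfold pole_sum. rewrite (Series_ext _ _ (pole_term_0 l t)).
rewrite Series_scal_l, <- kernel_PI_series. unfold kernel, sinh, cosh.
rewrite cos_PI, exp_Ropp. pose proof (exp_pos (t - l)). field. split; nra.
Qed.

Lemma exp_ell z : -1 < z < 0 -> exp (ell z) = - ((1 + z) / z).
Proof.
intros Hz. unfold ell.
assert ((1 + z) / z < 0).
{ unfold Rdiv. assert (/ z < 0) by (apply Rinv_lt_0_compat; lra). nra. }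
rewrite Rabs_left by auto. apply exp_ln. lra.
Qed.

(** Since [exp (- ell z) = - z / (1 + z)], the generating function times [1 + z] is
    [pole_sum (ell z) 0], and [pseries_coeff] reads off its coefficients. *)
Lemma geometric_polynomials_pole_series P n z :
  geometric_polynomials P -> -1 < z < 0 ->
  (1 + z) * P (S n) z / INR (fact (S n)) =
  Series (fun k => 2 * Re (/ pole (ell z) k ^ S (S n))).
Proof.
intros HP Hz.
pose proof (pseries_coeff (S n) (fun m => (1 + z) * P m z / INR (fact m))
  (pole_sum (ell z)) (pole_sum_continuity _) (pole_sum_rec _)) as H.
rewrite H; clear H.
- unfold pole_sum. rewrite Rplus_0_l. apply Series_ext. intros k.
  unfold pole_term. rewrite Rminus_0_r, (Cpow_S _ (S n)), Cmult_comm. reflexivity.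
- apply filter_imp with (2 := HP z). intros t Ht. apply is_pseries_R.
  apply (is_series_scal_l (1 + z)) in Ht.
  replace (pole_sum (ell z) 0 t) with (scal (1 + z) (1 / (1 - z * (exp t - 1)))).
  + apply is_series_ext with (2 := Ht). intros m.
    change ((1 + z) * (P m z * (t ^ m / INR (fact m))) = (1 + z) * P m z / INR (fact m) * t ^ m).
    field. apply INR_fact_neq_0.
  + rewrite pole_sum_0. change (scal ?a ?b) with (a * b).
    unfold Rminus at 3. rewrite exp_plus, exp_Ropp, exp_ell by auto.
    pose proof (exp_pos t). assert (0 < - z * exp t) by nra.
    apply (eq_trans (y := (1 + z) / (1 + z - z * exp t)) (A := R)); field; repeat split; nra.
Qed.

(** * Uniform estimate *)

Lemma Cmod_sqr w : Cmod w ^ 2 = fst w ^ 2 + snd w ^ 2.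
Proof.
unfold Cmod. apply pow2_sqrt.
pose proof (pow2_ge_0 (fst w)). pose proof (pow2_ge_0 (snd w)). lra.
Qed.

Lemma ell_pow_pole n z : ell_pow n z = Cmod (pole (ell z) 0) ^ S n.
Proof.
pose proof (Cmod_pole_gt_0 (ell z) 0) as Hc.
unfold ell_pow. replace (ell z ^ 2 + PI ^ 2) with (Cmod (pole (ell z) 0) ^ 2).
- rewrite <- (Rpower_pow 2), Rpower_mult, <- (Rpower_pow (S n)) by auto.
  f_equal. rewrite (S_INR n). change (INR 2) with 2. field.
- rewrite Cmod_sqr. unfold pole. simpl. ring.
Qed.

(** Both [w + Cconj w = 2 Re w] and [Re (/ w) = Re w / |w|^2] are used. With [w] a power of
    [pole l 0] the left side is [J]. *)
Lemma Cplus_conj_div_Cmod (w : C) : w <> 0 ->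
  ((w + Cconj w) / RtoC (Cmod w))%C = RtoC (2 * Re (/ w) * Cmod w).
Proof.
intros Hw. apply Cmod_gt_0 in Hw. pose proof (Cmod_sqr w) as H2.
unfold Cdiv. rewrite <- RtoC_inv by lra.
apply injective_projections; destruct w as [x y]; unfold Cconj, Cmult, Cplus, RtoC, Re, Cinv; simpl fst in *; simpl snd in *.
- replace (x * (x * 1) + y * (y * 1)) with (Cmod (x, y) ^ 2) by (rewrite H2; ring). field. lra.
- ring.
Qed.

Lemma J_pole n z :
  J n z = RtoC (2 * Re (/ pole (ell z) 0 ^ S n) * ell_pow n z).
Proof.
pose proof (pole_neq_0 (ell z) 0) as Hp.
unfold J. rewrite ell_pow_pole, <- Cmod_pow.
rewrite <- Cplus_conj_div_Cmod by (apply Cpow_nz; exact Hp).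
replace (n + 1)%nat with (S n) by lia.
rewrite Cpow_conj.
do 3 f_equal; f_equal; apply injective_projections; unfold pole; simpl; ring.
Qed.

(** [J] cancels exactly the term [k = 0] of the pole series. *)
Lemma deviation_pole P n z :
  geometric_polynomials P -> -1 < z < 0 ->
  deviation P (S n) z =
  RtoC (Series (fun k => 2 * Re (/ pole (ell z) (S k) ^ S (S n)))
    * Cmod (pole (ell z) 0) ^ S (S n)).
Proof.
intros HP Hz. unfold deviation. rewrite J_pole, <- RtoC_minus. f_equal.
replace ((1 + z) * P (S n) z * ell_pow (S n) z / INR (fact (S n)))
  with ((1 + z) * P (S n) z / INR (fact (S n)) * ell_pow (S n) z)
  by (field; apply INR_fact_neq_0).
rewrite geometric_polynomials_pole_series, ell_pow_pole by auto.
rewrite Series_incr_1; [ring|].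
apply ex_series_ext with (pole_term (S n) (ell z) 0); [|apply ex_series_pole_term].
intros k. unfold pole_term. rewrite Rminus_0_r, (Cpow_S _ (S n)), Cmult_comm. reflexivity.
Qed.

Lemma Cmod_pole_sqr l k : Cmod (pole l k) ^ 2 = l ^ 2 + ((2 * INR k + 1) * PI) ^ 2.
Proof. apply Cmod_sqr. Qed.

Lemma exp_nondecreasing x y : x <= y -> exp x <= exp y.
Proof.
intros [H| ->]; [apply Rlt_le, exp_increasing; exact H | apply Rle_refl].
Qed.

(** The squared ratio is at most [1 - 8 PI^2 / (l^2 + 9 PI^2)], the worst case being [k = 0]; then
    [1 + x <= exp x]. *)
Lemma pole_ratio_le l k :
  Cmod (pole l 0) / Cmod (pole l (S k)) <= exp (- (4 * PI ^ 2 / (l ^ 2 + 9 * PI ^ 2))).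
Proof.
pose proof PI_RGT_0 as Hpi. pose proof (pow2_ge_0 l) as Hl.
assert (Hpi2 : 0 < PI ^ 2) by (apply pow_lt; lra).
pose proof (Cmod_pole_gt_0 l 0) as H0. pose proof (Cmod_pole_gt_0 l (S k)) as Hk.
apply Rsqr_incr_0_var; [|apply Rlt_le, exp_pos].
rewrite !Rsqr_pow2. unfold Rdiv at 1. rewrite Rpow_mult_distr, pow_inv, !Cmod_pole_sqr.
rewrite <- (Rpower_pow 2 (exp _)) by apply exp_pos. unfold Rpower. rewrite ln_exp.
change (INR 2) with 2.
eapply Rle_trans; [|apply exp_ineq1_le].
replace (1 + 2 * - (4 * PI ^ 2 / (l ^ 2 + 9 * PI ^ 2)))
  with ((l ^ 2 + PI ^ 2) * / (l ^ 2 + 9 * PI ^ 2)) by (field; lra).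
replace (l ^ 2 + ((2 * INR 0 + 1) * PI) ^ 2) with (l ^ 2 + PI ^ 2) by (simpl; ring).
apply Rmult_le_compat_l; [lra|].
apply Rinv_le_contravar; [lra|].
rewrite S_INR. pose proof (pos_INR k).
assert (9 <= (2 * (INR k + 1) + 1) ^ 2) by nra.
rewrite Rpow_mult_distr. nra.
Qed.

(** The term of index [k] is at most [2 rho^(N+1)], where [N] is the index of the polynomial and
    [rho] the ratio of moduli. Two factors [rho] pay for summability in [k] at the cost of a factor
    [N]; the other [N - 1] gain [1/N^2]. *)
Lemma deviation_bound P n z :
  geometric_polynomials P -> -1 < z < 0 -> (3 <= n)%nat ->
  ell z ^ 2 + 9 * PI ^ 2 <= PI ^ 2 * (INR n / ln (INR n)) ->
  Cmod (deviation P n z) <= 2 * Series (fun k => / (2 * INR k + 1) ^ 2) / INR n.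
Proof.
intros HP Hz Hn Hl.
destruct n as [|[|n]]; [lia|lia|].
rewrite deviation_pole, Cmod_R, <- Series_scal_r by auto.
unfold Rdiv. rewrite Rmult_assoc, <- (Rmult_comm (/ _)), <- Rmult_assoc, <- Series_scal_l.
set (l := ell z) in *. set (N := S (S n)) in *.
assert (HN : 3 <= INR N) by (replace 3 with (INR 3) by (simpl; ring); apply le_INR; auto).
assert (Hln : 1 <= ln (INR N)).
{ rewrite <- (ln_exp 1). apply ln_le; [apply exp_pos|]. pose proof exp_le_3. lra. }
pose proof PI_RGT_0 as Hpi.
assert (Hpi2 : 0 < PI ^ 2) by (apply pow_lt; lra).
pose proof (pow2_ge_0 l) as Hl0.
apply Series_dominated; [|apply (ex_series_scal (V := R_NormedModule)), ex_series_inv_odd_sqr].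
intros k.
pose proof (Cmod_pole_gt_0 l 0) as H0. pose proof (Cmod_pole_gt_0 l (S k)) as Hk.
set (rho := Cmod (pole l 0) / Cmod (pole l (S k))).
assert (Hrho : 0 < rho) by (apply Rdiv_lt_0_compat; auto).
apply Rle_trans with (2 * (rho ^ 2 * rho ^ n * rho)).
{ rewrite Rabs_mult, (Rabs_pos_eq (_ ^ _)) by (apply pow_le; lra).
  replace (2 * (rho ^ 2 * rho ^ n * rho))
    with (2 * / Cmod (pole l (S k)) ^ S N * Cmod (pole l 0) ^ S N).
  - apply Rmult_le_compat_r; [apply pow_le; lra|].
    apply Rabs_Re_inv_le; [apply pow_lt; auto|]. rewrite Cmod_pow. lra.
  - unfold N. replace (rho ^ 2 * rho ^ n * rho) with (rho ^ S (S (S n))) by (simpl; ring).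
    unfold rho, Rdiv. rewrite Rpow_mult_distr, pow_inv. ring. }
(* The hypothesis on [ell z] gives [rho <= exp (-4 ln N / N)], and [4 (N - 1) >= 2 N]. *)
assert (Hexp : rho ^ n * rho <= / INR N ^ 2).
{ assert (Hr : rho <= exp (- (4 * ln (INR N) / INR N))).
  { eapply Rle_trans; [apply pole_ratio_le|].
    apply exp_nondecreasing. apply Ropp_le_contravar.
    apply (Rmult_le_reg_r (l ^ 2 + 9 * PI ^ 2)); [lra|].
    unfold Rdiv at 2. rewrite Rmult_assoc, Rinv_l, Rmult_1_r by lra.
    replace (4 * PI ^ 2) with (4 * ln (INR N) / INR N * (PI ^ 2 * (INR N / ln (INR N))))
      by (field; lra).
    apply Rmult_le_compat_l; auto.
    apply Rlt_le, Rdiv_lt_0_compat; lra. }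
  replace (rho ^ n * rho) with (rho ^ S n) by (simpl; ring).
  apply Rle_trans with (exp (- (4 * ln (INR N) / INR N)) ^ S n).
  { apply pow_incr. lra. }
  rewrite <- Rpower_pow by apply exp_pos. unfold Rpower. rewrite ln_exp.
  rewrite <- (Rpower_pow 2) by lra. unfold Rpower. rewrite <- exp_Ropp.
  apply exp_nondecreasing. change (INR 2) with 2.
  replace (INR (S n)) with (INR N - 1) by (unfold N; rewrite (S_INR (S n)); ring).
  apply (Rmult_le_reg_r (INR N)); [lra|].
  replace ((INR N - 1) * - (4 * ln (INR N) / INR N) * INR N)
    with (- (4 * (INR N - 1) * ln (INR N))) by (field; lra).
  nra. }
(* The numerator is at most [PI^2 N] because [ln N >= 1]; the denominator is at least
   [(2k+1)^2 PI^2]. *)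
assert (Hsq : rho ^ 2 <= INR N * / (2 * INR k + 1) ^ 2).
{ unfold rho, Rdiv. rewrite Rpow_mult_distr, pow_inv, !Cmod_pole_sqr.
  replace (l ^ 2 + ((2 * INR 0 + 1) * PI) ^ 2) with (l ^ 2 + PI ^ 2) by (simpl; ring).
  assert (Hnum : l ^ 2 + PI ^ 2 <= PI ^ 2 * INR N).
  { apply Rle_trans with (PI ^ 2 * (INR N / ln (INR N))); [lra|].
    apply Rmult_le_compat_l; [lra|].
    apply (Rmult_le_reg_r (ln (INR N))); [lra|].
    unfold Rdiv. rewrite Rmult_assoc, Rinv_l by lra. nra. }
  rewrite S_INR. pose proof (pos_INR k).
  replace (INR N * / (2 * INR k + 1) ^ 2)
    with (PI ^ 2 * INR N * / ((2 * INR k + 1) ^ 2 * PI ^ 2)) by (field; lra).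
  assert (0 < (2 * INR k + 1) ^ 2 * PI ^ 2).
  { apply Rmult_lt_0_compat; [apply pow_lt|]; lra. }
  assert ((2 * INR k + 1) ^ 2 * PI ^ 2 <= l ^ 2 + ((2 * (INR k + 1) + 1) * PI) ^ 2).
  { rewrite Rpow_mult_distr.
    assert ((2 * INR k + 1) ^ 2 <= (2 * (INR k + 1) + 1) ^ 2) by (apply pow_incr; lra).
    nra. }
  apply Rmult_le_compat; try lra.
  - apply Rlt_le, Rinv_0_lt_compat. lra.
  - apply Rinv_le_contravar; auto. }
rewrite Rmult_assoc.
replace (2 * / INR N * / (2 * INR k + 1) ^ 2)
  with (2 * (INR N * / (2 * INR k + 1) ^ 2 * / INR N ^ 2))
  by (pose proof (pos_INR k); field; lra).
apply Rmult_le_compat_l; [lra|].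
apply Rmult_le_compat; auto.
- apply pow_le; lra.
- apply Rmult_le_pos; [apply pow_le|]; lra.
Qed.

(** [ell] increases on [(-1, 0)] and takes the values [- L] and [L] at the endpoints of the
    interval. *)
Lemma ell_sqr_le c n z : zseq c n <= z <= -1 - zseq c n ->
  -1 < z < 0 /\ ell z ^ 2 <= Lseq c n ^ 2.
Proof.
unfold zseq. set (L := Lseq c n). intros [H1 H2].
pose proof (exp_pos L) as HE. pose proof (exp_Ropp L) as HEn.
set (E := exp L) in *.
assert (HD : E / (1 + E) = 1 - / (1 + E)) by (field; lra).
assert (Hi : 0 < / (1 + E)) by (apply Rinv_0_lt_compat; lra).
assert (Hi2 : (1 + E) * / (1 + E) = 1) by (apply Rinv_r; lra).
rewrite HD in *.
assert (Hz : -1 < z < 0) by nra.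
split; auto.
pose proof (exp_ell z Hz) as Hell.
assert (Hq : - ((1 + z) / z) * - z = 1 + z) by (field; lra).
rewrite <- Hell in Hq.
assert (Hup : ell z <= L).
{ destruct (Rle_or_lt (ell z) L) as [|Hlt]; auto.
  apply exp_increasing in Hlt. fold E in Hlt. nra. }
assert (Hlo : - L <= ell z).
{ destruct (Rle_or_lt (- L) (ell z)) as [|Hlt]; auto.
  apply exp_increasing in Hlt. rewrite HEn in Hlt.
  assert (E * / E = 1) by (apply Rinv_r; lra).
  assert (E * exp (ell z) < 1) by nra. nra. }
nra.
Qed.

(** From [ln x = 2 ln (sqrt x)]; it yields [n / ln n >= sqrt n / 2]. *)
Lemma ln_le_sqrt x : 0 < x -> ln x <= 2 * sqrt x.
Proof.
intros Hx. pose proof (sqrt_lt_R0 x Hx) as Hs.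
rewrite <- (sqrt_sqrt x) at 1 by lra. rewrite ln_mult by auto.
assert (ln (sqrt x) <= sqrt x); [|lra].
apply Rlt_le, exp_lt_inv. rewrite exp_ln by auto.
pose proof (exp_ineq1_le (sqrt x)). lra.
Qed.

Theorem theorem1 (P : nat -> R -> R) (hP : geometric_polynomials P)
    (c : R) (hc : 0 < c < PI / sqrt 2) :
  forall eps : R, 0 < eps ->
    exists N : nat, forall n : nat, (3 <= n)%nat -> (N <= n)%nat ->
      forall z : R, zseq c n <= z <= - 1 - zseq c n ->
        Cmod (deviation P n z) < eps.
Proof.
intros eps Heps.
set (S0 := Series (fun k => / (2 * INR k + 1) ^ 2)).
destruct (nfloor_ex (Rabs (2 * S0 / eps)) (Rabs_pos _)) as [M [_ HM]].
(* [1296 = 36^2] ensures [n / ln n >= 18], and [S M] ensures [n > 2 S0 / eps]. *)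
exists (Nat.max 1296 (S M)). intros n Hn3 HnN z Hz.
apply ell_sqr_le in Hz. destruct Hz as [Hz Hell].
assert (Hn : 1296 <= INR n).
{ replace 1296 with (INR 1296) by (rewrite INR_IZR_INZ; reflexivity). apply le_INR. lia. }
assert (HnM : INR M + 1 <= INR n) by (rewrite <- S_INR; apply le_INR; lia).
assert (Hln : 1 <= ln (INR n)).
{ rewrite <- (ln_exp 1). apply ln_le; [apply exp_pos|]. pose proof exp_le_3. lra. }
pose proof (ln_le_sqrt (INR n) ltac:(lra)) as Hsq.
assert (Hs36 : 36 <= sqrt (INR n)).
{ rewrite <- (sqrt_pow2 36) by lra. apply sqrt_le_1_alt. lra. }
pose proof (sqrt_sqrt (INR n) ltac:(lra)) as Hss.
assert (Hr : 18 <= INR n / ln (INR n)).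
{ apply (Rmult_le_reg_r (ln (INR n))); [lra|].
  unfold Rdiv. rewrite Rmult_assoc, Rinv_l by lra. nra. }
assert (Hc2 : c ^ 2 <= PI ^ 2 / 2).
{ replace (PI ^ 2 / 2) with ((PI / sqrt 2) ^ 2).
  - apply pow_incr. lra.
  - unfold Rdiv. rewrite Rpow_mult_distr, pow_inv, pow2_sqrt by lra. ring. }
pose proof (pow2_ge_0 PI) as Hpi2.
apply Rle_lt_trans with (2 * S0 / INR n).
- apply deviation_bound; auto.
  assert (HL : Lseq c n ^ 2 = c ^ 2 * (INR n / ln (INR n))).
  { unfold Lseq. rewrite Rpow_mult_distr, pow2_sqrt; lra. }
  (* With [r = n / ln n], half of [PI^2 r] absorbs [c^2 r] because [c^2 <= PI^2 / 2], and the other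
     half absorbs [9 PI^2] because [r >= 18]. *)
  rewrite HL in Hell. nra.
- apply (Rmult_lt_reg_r (INR n)); [lra|].
  unfold Rdiv. rewrite Rmult_assoc, Rinv_l, Rmult_1_r by lra.
  pose proof (Rle_abs (2 * S0 / eps)) as Ha.
  replace (2 * S0) with (eps * (2 * S0 / eps)) by (field; lra).
  apply Rmult_lt_compat_l; lra.
Qed.
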